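(* Let $\mathbb{F}$ be either $\mathbb{R}$ or $\mathbb{C}$, let $X$ be an infinite-dimensional vector space over $\mathbb{F}$, and let $S\colon X\to\mathbb{R}$ be a seminorm on $X$ with $S\neq 0$ (i.e. $S$ is not identically zero). Then: (a) There exists a norm $N$ on $X$ such that $S$ is continuous at every point of $X$ with respect to the topology induced by $N$. (b) There exists a norm $N'$ on $X$ such that $S$ is discontinuous at every point of $X$ with respect to the topology induced by $N'$.
   Context: A seminorm on a vector space $X$ over $\mathbb{F}$ is a function $S\colon X\to\mathbb{R}$ such that, for all $x,y\in X$ and $\alpha\in\mathbb{F}$: $S(x)\geq 0$, $S(\alpha x)=|\alpha|S(x)$, and $S(x+y)\leq S(x)+S(y)$. A norm is a seminorm $N$ with $N(x)>0$ for all $x\neq 0$. ''Infinite-dimensional'' means having no finite (Hamel) basis. Continuity of $S$ is understood as a map from $X$, with the topology induced by the norm, to $\mathbb{R}$ with its usual topology. *)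

(* Defs.v *)
From HB Require Import structures.
From mathcomp Require Import all_boot all_order all_algebra.
From mathcomp Require Import complex.
From mathcomp Require Import boolp classical_sets reals topology normedtype.

Set Implicit Arguments.
Unset Strict Implicit.
Unset Printing Implicit Defensive.

Import Order.TTheory GRing.Theory Num.Theory.
Import numFieldNormedType.Exports.

Local Open Scope ring_scope.
Local Open Scope complex_scope.

Variant field_choice := RealField | ComplexField.

Definition scalars (R : realType) (k : field_choice) : numFieldType :=
  match k with
  | RealField => R
  | ComplexField => R[i]
  end.

(* The library norm `|z| of z : R[i] lives in R[i]; normc is its R-valued
   version, sqrt (Re z ^ 2 + Im z ^ 2). *)
Definition modulus (R : realType) (k : field_choice) : scalars R k -> R :=
  match k return scalars R k -> R with
  | RealField => fun a : R => `|a|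
  | ComplexField => fun z : R[i] => ComplexField.Normc.normc z
  end.

Definition linearly_independent (F : fieldType) (X : lmodType F) (n : nat)
    (e : 'I_n -> X) : Prop :=
  forall c : 'I_n -> F, \sum_(i < n) c i *: e i = 0 -> forall i, c i = 0.

Definition spanning (F : fieldType) (X : lmodType F) (n : nat)
    (e : 'I_n -> X) : Prop :=
  forall x : X, exists c : 'I_n -> F, x = \sum_(i < n) c i *: e i.

Definition infinite_dimensional (F : fieldType) (X : lmodType F) : Prop :=
  ~ exists (n : nat) (e : 'I_n -> X), linearly_independent e /\ spanning e.

Record seminorm (R : realType) (k : field_choice)
    (X : lmodType (scalars R k)) := Seminorm {
  seminorm_fun :> X -> R;
  seminorm_ge0 : forall x, 0 <= seminorm_fun x;
  seminormZ : forall (a : scalars R k) x,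
    seminorm_fun (a *: x) = modulus a * seminorm_fun x;
  seminormD : forall x y,
    seminorm_fun (x + y) <= seminorm_fun x + seminorm_fun y
}.

Record vnorm (R : realType) (k : field_choice)
    (X : lmodType (scalars R k)) := VNorm {
  vnorm_seminorm :> seminorm X;
  vnorm_gt0 : forall x, x != 0 -> 0 < vnorm_seminorm x
}.

Lemma modulus_nat (R : realType) (k : field_choice) (n : nat) :
  modulus (n%:R : scalars R k) = n%:R.
Proof.
case: k => /=; first exact: normr_nat.
by apply: complexI; rewrite -[LHS]/(`|n%:R : R[i]|) normr_nat rmorph_nat.
Qed.

Lemma modulusN1 (R : realType) (k : field_choice) :
  modulus (-1 : scalars R k) = 1.
Proof.
case: k => /=; first by rewrite normrN1.
by apply: complexI; rewrite -[LHS]/(`|-1 : R[i]|) normrN1.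
Qed.

(* X topologized by N: an alias of X depending on N, so that one space can
   carry several norms. As N is R-valued also over the complex scalars, the
   alias is a normed Zmodule over R, and its topology is the one the library
   derives from the balls {y | N (x - y) < r}. *)
Definition normed_by (R : realType) (k : field_choice)
  (X : lmodType (scalars R k)) (N : vnorm X) : Type := X.

HB.instance Definition _ (R : realType) (k : field_choice)
    (X : lmodType (scalars R k)) (N : vnorm X) :=
  GRing.Zmodule.copy (normed_by N) X.

Lemma normed_by_eq0 (R : realType) (k : field_choice)
    (X : lmodType (scalars R k)) (N : vnorm X) (x : normed_by N) :
  N x = 0 -> x = 0.
Proof.
move=> Nx0; apply/eqP; apply: contraT => x0.
by have := vnorm_gt0 N x0; rewrite Nx0 ltxx.
Qed.

Lemma normed_byMn (R : realType) (k : field_choice)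
    (X : lmodType (scalars R k)) (N : vnorm X) (x : normed_by N) (n : nat) :
  N (x *+ n) = N x *+ n.
Proof.
by rewrite -[x *+ n](scaler_nat n (x : X)) seminormZ modulus_nat mulr_natl.
Qed.

Lemma normed_byN (R : realType) (k : field_choice)
    (X : lmodType (scalars R k)) (N : vnorm X) (x : normed_by N) :
  N (- x) = N x.
Proof. by rewrite -[- x](scaleN1r (x : X)) seminormZ modulusN1 mul1r. Qed.

HB.instance Definition _ (R : realType) (k : field_choice)
    (X : lmodType (scalars R k)) (N : vnorm X) :=
  Num.Zmodule_isNormed.Build R (normed_by N)
    (seminormD N) (@normed_by_eq0 R k X N) (@normed_byMn R k X N)
    (@normed_byN R k X N).

HB.instance Definition _ (R : realType) (k : field_choice)
    (X : lmodType (scalars R k)) (N : vnorm X) :=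
  PseudoMetric.copy (normed_by N) (pseudoMetric_normed (normed_by N)).

(* Main.v *)
Require Import Defs.
From mathcomp Require Import all_boot all_order all_algebra.
From mathcomp Require Import complex.
From mathcomp Require Import boolp classical_sets functions cardinality.
From mathcomp Require Import reals topology normedtype.

Set Implicit Arguments.
Unset Strict Implicit.
Unset Printing Implicit Defensive.

Import Order.TTheory GRing.Theory Num.Theory.
Import numFieldNormedType.Exports.

Local Open Scope ring_scope.
Local Open Scope classical_set_scope.

(** The vectors outside the kernel of a nonzero seminorm [S] span the space: if
   [S x = 0] and [S v0 != 0] then [x] is the difference of [x + v0] and [v0],
   on both of which [S] is nonzero. Hence there is a Hamel basis [B] with
   [S b != 0] for every [b] in [B] ([hamel_basis_in]), and [B] is infinite
   because the space is infinite-dimensional ([infinite_basis]).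

   Positive weights [w] on [B] define a norm, the supremum over [b] in [B] of
   [w b] times the modulus of the [b]-th coordinate ([wsup_norm]); this norm
   takes a value at most [w b] at [b].

   For a norm making [S] continuous, add [S] to the norm with all weights [1]:
   the sum dominates [S], and a seminorm dominated by a norm is 1-Lipschitz
   for it ([dominated_continuous]).

   For a norm making [S] discontinuous everywhere, take a map [h] from [B] onto
   the natural numbers and the weights [S b / (h b + 1)]. At the vectors of [B]
   the seminorm is then at least [h b + 1] times the norm, so no multiple of
   the norm dominates [S]; but continuity of [S] at a single point would
   provide such a multiple ([continuous_at_bounded]). *)

(** * Spans, independent sets and Hamel bases *)

Definition subspace (F : fieldType) (X : lmodType F) (W : set X) : Prop :=
  W 0 /\ forall (a : F) x y, W x -> W y -> W (a *: x + y).

(** The span is encoded as the intersection of all subspaces containing [A], so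
   that proving a property of its elements amounts to checking that this
   property defines a subspace; no linear combination has to be written. *)
Definition lin_span (F : fieldType) (X : lmodType F) (A : set X) : set X :=
  [set x | forall W, subspace W -> A `<=` W -> W x].

Definition independent (F : fieldType) (X : lmodType F) (B : set X) : Prop :=
  forall b, B b -> ~ lin_span (B `\ b) b.

Section Spans.
Variables (F : fieldType) (X : lmodType F).
Implicit Types (A B W : set X) (x y : X).

Lemma lin_span_subspace A : subspace (lin_span A).
Proof.
split=> [W [W0 _] _ //|a x y Ax Ay W sW AW].
by apply: sW.2; [apply: Ax|apply: Ay].
Qed.

Lemma subset_lin_span A : A `<=` lin_span A.
Proof. by move=> x Ax W _; apply. Qed.

Lemma lin_span_min A W : subspace W -> A `<=` W -> lin_span A `<=` W.
Proof. by move=> sW AW x; apply. Qed.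

Lemma lin_spanS A B : A `<=` B -> lin_span A `<=` lin_span B.
Proof.
move=> AB; apply: lin_span_min; first exact: lin_span_subspace.
by move=> x /AB; exact: subset_lin_span.
Qed.

Lemma lin_span0 x : lin_span set0 x -> x = 0.
Proof.
apply: (@lin_span_min _ [set 0]) => //; split=> // a y z -> ->.
by rewrite scaler0 addr0.
Qed.

Lemma subspaceZ W a x : subspace W -> W x -> W (a *: x).
Proof. by move=> [W0 Wl] Wx; rewrite -[_ *: _]addr0; exact: Wl. Qed.

Lemma subspaceB W x y : subspace W -> W x -> W y -> W (x - y).
Proof. by move=> sW Wx Wy; rewrite addrC -scaleN1r; apply: sW.2. Qed.

(** The vectors that differ from a multiple of [b] by an element of the span of
   [A] form a subspace, which contains [b] and [A]. *)
Lemma lin_spanU1 A b x : lin_span (b |` A) x ->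
  exists a, lin_span A (x - a *: b).
Proof.
have [A0 Al] := lin_span_subspace A.
apply: (@lin_span_min _ [set x | exists a, lin_span A (x - a *: b)]).
  split=> [|a y z [c Ay] [d Az]]; first by exists 0; rewrite scale0r subr0.
  exists (a * c + d); rewrite scalerDl opprD addrACA -scalerA -scalerBr.
  exact: Al.
move=> y [->|Ay] /=; first by exists 1; rewrite scale1r subrr.
by exists 0; rewrite scale0r subr0; exact: subset_lin_span.
Qed.

(** Membership in a span is witnessed by finitely many vectors; the union of
   the spans of finite subsets of [A] is itself a subspace. *)
Lemma lin_span_finitary A x : lin_span A x ->
  exists2 s : seq X, [set` s] `<=` A & lin_span [set` s] x.
Proof.
apply: (@lin_span_min _
  [set x | exists2 s : seq X, [set` s] `<=` A & lin_span [set` s] x]).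
  split=> [|a y z [s sA sy] [t tA tz]].
    by exists nil => //; exact: (lin_span_subspace _).1.
  exists (s ++ t) => [u /=|].
    by rewrite mem_cat => /orP[/sA|/tA].
  apply: (lin_span_subspace _).2.
    by apply: lin_spanS sy => u /= us; rewrite mem_cat us.
  by apply: lin_spanS tz => u /= ut; rewrite mem_cat ut orbT.
move=> y Ay; exists [:: y]; first by move=> z /=; rewrite inE => /eqP->.
by apply: subset_lin_span => /=; rewrite inE.
Qed.

(** The chain condition of Zorn's lemma, a consequence of finitarity. *)
Lemma independent_bigcup (C : set (set X)) :
  C `<=` @independent F X -> total_on C subset ->
  independent (\bigcup_(B in C) B).
Proof.
move=> iC totC b [B0 CB0 B0b] /lin_span_finitary[s sC sb].
(* The finitely many vectors generating b lie in one member of the chain. *)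
have [B [CB Bb sB]] : exists B, [/\ C B, B b & [set` s] `<=` B `\ b].
  elim: s sC {sb} => [_|y s IHs ysC]; first by exists B0; split.
  have [B [CB Bb sB]] : exists B, [/\ C B, B b & [set` s] `<=` B `\ b].
    by apply: IHs => z /= zs; apply: ysC; rewrite /= inE zs orbT.
  have [[D CD Dy] yb] : (\bigcup_(B in C) B `\ b) y.
    by apply: ysC; rewrite /= inE eqxx.
  have [BD|DB] := totC _ _ CB CD.
    exists D; split=> //; first exact: BD.
    move=> z /=; rewrite inE => /orP[/eqP->//|/sB[/BD Dz zb]].
    by split.
  exists B; split=> // z /=; rewrite inE => /orP[/eqP->|/sB//].
  by split=> //; exact: DB.
by apply: (iC _ CB _ Bb); exact: lin_spanS sb.
Qed.

(** Exchange argument: if some [b] in [B] depends on [x] and the rest of [B],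
   the coefficient of [x] is nonzero as [B] is independent, so [x] can be solved
   for and lies in the span of [B]. *)
Lemma independentU1 B x : independent B -> ~ lin_span B x ->
  independent (x |` B).
Proof.
move=> iB Bx b bxB bspan.
have [bx|bx] := pselect (b = x).
  apply: Bx; rewrite -bx; apply: lin_spanS bspan => y [[-> // yb|//]].
  by case: yb.
have Bb : B b by case: bxB.
have [|a ha] := @lin_spanU1 (B `\ b) x b.
  by apply: lin_spanS bspan => y [[->|By] yb]; [left|right].
have [a0|a0] := eqVneq a 0.
  by apply: (iB b Bb); rewrite a0 scale0r subr0 in ha.
apply: Bx.
have -> : x = a^-1 *: (b - (b - a *: x)).
  by rewrite opprB addrC subrK scalerA mulVf ?scale1r.
have sB := lin_span_subspace B.
apply: (subspaceZ _ sB); apply: (subspaceB sB); first exact: subset_lin_span.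
by apply: lin_spanS ha; exact: subDsetl.
Qed.

(** A maximal independent subset of [A] must span [A], since any other element
   of [A] could be adjoined to it. *)
Lemma hamel_basis_in A : lin_span A = setT ->
  exists B, [/\ B `<=` A, independent B & lin_span B = setT].
Proof.
move=> spanA.
have [C CP totC|B [[BA iB] maxB]] :=
    @Zorn_bigcup X [set B | B `<=` A /\ independent B].
  split=> [x [B CB Bx]|]; first exact: (CP B CB).1.
  by apply: independent_bigcup => // B /CP[].
exists B; split=> //; apply/seteqP; split=> // x _.
have : lin_span A x by rewrite spanA.
apply: lin_span_min; first exact: lin_span_subspace.
move=> y Ay; apply: contrapT => By; apply: (maxB (y |` B)).
  split; first by move=> z Bz; right.
  by move/(_ y (or_introl erefl)) => /subset_lin_span.
split; last exact: independentU1.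
by move=> z [->//|/BA].
Qed.

End Spans.

(** * Coordinates with respect to a Hamel basis *)

(** The [b]-th coordinate of [x]: the only scalar that moves [x] along [b]
   into the hyperplane spanned by the other basis vectors. *)
Definition coord (F : fieldType) (X : lmodType F) (B : set X) (b x : X) : F :=
  xget 0 [set a | lin_span (B `\ b) (x - a *: b)].

Section Coordinates.
Variables (F : fieldType) (X : lmodType F) (B : set X).
Hypotheses (iB : independent B) (spanB : lin_span B = setT).

Lemma coordE b x a : B b -> lin_span (B `\ b) (x - a *: b) ->
  coord B b x = a.
Proof.
move=> Bb xa; apply: xget_subset1 => // c d /= xc xd.
apply/eqP; apply: contrapT => /negP; rewrite -subr_eq0 => cd.
have sB := lin_span_subspace (B `\ b).
apply: (iB Bb).
have bE : b = (c - d)^-1 *: ((x - d *: b) - (x - c *: b)).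
  rewrite opprB [_ + (_ - x)]addrC addrA subrK -scalerBl scalerA.
  by rewrite mulVf ?scale1r.
by rewrite [X in lin_span _ X]bE; apply: (subspaceZ _ sB);
  exact: (subspaceB sB).
Qed.

Lemma coordP b x : B b -> lin_span (B `\ b) (x - coord B b x *: b).
Proof.
move=> Bb; have [|a xa] := @lin_spanU1 _ _ (B `\ b) b x.
  by rewrite setD1K // spanB.
by rewrite (coordE Bb xa).
Qed.

Lemma coord_linear b a x y : B b ->
  coord B b (a *: x + y) = a * coord B b x + coord B b y.
Proof.
move=> Bb; apply: coordE => //.
rewrite scalerDl opprD addrACA -scalerA -scalerBr.
by apply: (lin_span_subspace _).2; exact: coordP.
Qed.

Lemma coord_span_compl b x : B b -> lin_span (B `\ b) x -> coord B b x = 0.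
Proof. by move=> Bb xb; apply: coordE => //; rewrite scale0r subr0. Qed.

Lemma coord_id b : B b -> coord B b b = 1.
Proof.
move=> Bb; apply: coordE => //; rewrite scale1r subrr.
exact: (lin_span_subspace _).1.
Qed.

Lemma coord_neq b b' : B b -> B b' -> b' <> b -> coord B b b' = 0.
Proof.
move=> Bb Bb' neq; apply: coord_span_compl => //.
exact: subset_lin_span.
Qed.

Lemma coord0 b : B b -> coord B b 0 = 0.
Proof.
by move=> Bb; apply: coord_span_compl => //; exact: (lin_span_subspace _).1.
Qed.

Lemma coordZ b a x : B b -> coord B b (a *: x) = a * coord B b x.
Proof.
by move=> Bb; have := coord_linear a x 0 Bb; rewrite coord0 // !addr0.
Qed.

Lemma coordD b x y : B b -> coord B b (x + y) = coord B b x + coord B b y.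
Proof.
by move=> Bb; have := coord_linear 1 x y Bb; rewrite scale1r mul1r.
Qed.

Lemma coord_sum b n (c : 'I_n -> F) (e : 'I_n -> X) : B b ->
  coord B b (\sum_(i < n) c i *: e i) = \sum_(i < n) c i * coord B b (e i).
Proof.
move=> Bb; rewrite (big_morph (coord B b) (id1 := 0) (op1 := +%R)).
- by apply: eq_bigr => i _; rewrite coordZ.
- by move=> x y; rewrite coordD.
- by rewrite coord0.
Qed.

(** All basis vectors outside a finite set spanning [x] have [x] in the
   hyperplane spanned by the others. *)
Lemma coord_support x :
  exists s : seq X, forall b, B b -> b \notin s -> coord B b x = 0.
Proof.
have : lin_span B x by rewrite spanB.
move=> /lin_span_finitary[s sB sx]; exists s => b Bb bs.
apply: coord_span_compl => //; apply: lin_spanS sx => y /= ys.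
by split=> [|yb]; [exact: sB|rewrite yb (negbTE bs) in ys].
Qed.

(** A vector lies in the span of finitely many basis vectors, and these can be
   discarded one at a time when the corresponding coordinates vanish. *)
Lemma coord_eq0 x : (forall b, B b -> coord B b x = 0) -> x = 0.
Proof.
move=> x0; have : lin_span B x by rewrite spanB.
move=> /lin_span_finitary[s]; elim: s => [|b s IHs] sB sx.
  by apply: lin_span0; apply: lin_spanS sx.
have sB' : [set` s] `<=` B.
  by move=> y /= ys; apply: sB; rewrite /= inE ys orbT.
have Bb : B b by apply: sB; rewrite /= inE eqxx.
have [bs|bs] := boolP (b \in s).
  apply: IHs => //; apply: lin_spanS sx => y /=.
  by rewrite inE => /orP[/eqP->|].
have [|a xa] := @lin_spanU1 _ _ [set` s] b x.
  by apply: lin_spanS sx => y /=; rewrite inE => /orP[/eqP->|]; [left|right].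
apply: IHs => //; suff a0 : a = 0 by rewrite a0 scale0r subr0 in xa.
rewrite -(x0 b Bb); apply/esym/coordE => //; apply: lin_spanS xa => y /= ys.
by split=> [|yb]; [exact: sB'|rewrite yb (negbTE bs) in ys].
Qed.

(** A finite [B] would be a basis in the indexed sense of
   [infinite_dimensional]: applying a coordinate to a vanishing linear
   combination isolates each coefficient. *)
Lemma infinite_basis : infinite_dimensional X -> infinite_set B.
Proof.
move=> infX /finite_seqP[s0 Bs0]; apply: infX.
pose s := undup s0.
have Bs : B = [set` s].
  by rewrite Bs0; apply/seteqP; split=> x /=; rewrite mem_undup.
have us : uniq s by exact: undup_uniq.
pose e (i : 'I_(size s)) := s`_i.
have Be i : B (e i) by rewrite Bs /=; exact: mem_nth.
exists (size s), e; split=> [c ce0 i|x].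
  have := coord_sum c e (Be i); rewrite ce0 coord0 // => /esym.
  rewrite (bigD1 i) //= coord_id // mulr1 big1 ?addr0 // => j ji.
  rewrite coord_neq ?mulr0 // => /eqP.
  by rewrite nth_uniq // => /eqP/val_inj/eqP; rewrite (negbTE ji).
have : lin_span B x by rewrite spanB.
apply: (@lin_span_min _ _ _
  [set x | exists c : 'I_(size s) -> F, x = \sum_(i < size s) c i *: e i]).
  split=> [|a _ _ [c ->] [d ->]].
    by exists (fun=> 0); rewrite big1 // => i _; rewrite scale0r.
  exists (fun i => a * c i + d i); rewrite scaler_sumr -big_split /=.
  by apply: eq_bigr => i _; rewrite scalerDl scalerA.
move=> y; rewrite Bs /= => ys.
have ils : (index y s < size s)%N by rewrite index_mem.
exists (fun j => (j == Ordinal ils)%:R).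
rewrite (bigD1 (Ordinal ils)) //= eqxx scale1r big1 => [|j /negbTE->].
  by rewrite addr0 /e /= nth_index.
by rewrite scale0r.
Qed.

End Coordinates.

(** * Weighted supremum norms *)

Section Modulus.
Variables (R : realType) (k : field_choice).
Implicit Types a b : scalars R k.

Lemma modulus_ge0 a : 0 <= modulus a.
Proof.
by case: k a => /= a; [exact: normr_ge0|case: a => x y; exact: sqrtr_ge0].
Qed.

Lemma modulus0 : modulus (0 : scalars R k) = 0.
Proof. by have := modulus_nat R k 0; rewrite !mulr0n. Qed.

Lemma modulus1 : modulus (1 : scalars R k) = 1.
Proof. by have := modulus_nat R k 1; rewrite !mulr1n. Qed.

Lemma modulus_eq0 a : modulus a = 0 -> a = 0.
Proof.
by case: k a => /= a; [exact: normr0_eq0|exact: ComplexField.Normc.eq0_normc].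
Qed.

Lemma modulusM a b : modulus (a * b) = modulus a * modulus b.
Proof.
by case: k a b => /= a b; [exact: normrM|exact: ComplexField.Normc.normcM].
Qed.

Lemma le_modulusD a b : modulus (a + b) <= modulus a + modulus b.
Proof. by case: k a b => /= a b; [exact: ler_normD|exact: le_normcD]. Qed.

Lemma modulus_surj (r : R) : 0 <= r -> exists a : scalars R k, modulus a = r.
Proof.
move=> r0; case: k => /=; first by exists r; rewrite ger0_norm.
by exists r%:C%C; rewrite /= expr0n addr0 sqrtr_sqr ger0_norm.
Qed.

End Modulus.

Section WeightedSupNorm.
Variables (R : realType) (k : field_choice) (X : lmodType (scalars R k)).
Variables (B : set X) (w : X -> R).
Hypotheses (iB : independent B) (spanB : lin_span B = setT).
Hypotheses (B0 : B !=set0) (w_gt0 : forall b, B b -> 0 < w b).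

Definition wsup (x : X) : R :=
  sup [set w b * modulus (coord B b x) | b in B].

(** The supremum is over a bounded set: only finitely many coordinates of [x]
   are nonzero, so the sum of the corresponding terms is a bound. *)
Lemma wsup_ge b x : B b -> w b * modulus (coord B b x) <= wsup x.
Proof.
move=> Bb; apply: ub_le_sup; last by exists b.
have [s sx] := coord_support iB spanB x.
exists (\sum_(c <- s) `|w c * modulus (coord B c x)|) => _ [c Bc <-].
have [cs|cs] := boolP (c \in s); last first.
  by rewrite sx // modulus0 mulr0 sumr_ge0.
rewrite (big_rem c) //=; apply: (le_trans (ler_norm _)).
by rewrite lerDl sumr_ge0.
Qed.

Lemma wsup_le x r : (forall b, B b -> w b * modulus (coord B b x) <= r) ->
  wsup x <= r.
Proof.
move=> xr; apply: ge_sup => [|_ [b Bb <-]]; last exact: xr.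
by have [b Bb] := B0; exists (w b * modulus (coord B b x)); exists b.
Qed.

Lemma wsup_ge0 x : 0 <= wsup x.
Proof.
have [b Bb] := B0; apply: (le_trans _ (wsup_ge x Bb)).
by rewrite mulr_ge0 ?modulus_ge0 // ltW // w_gt0.
Qed.

Lemma wsupZ_le a x : wsup (a *: x) <= modulus a * wsup x.
Proof.
apply: wsup_le => b Bb; rewrite coordZ // modulusM mulrCA.
by apply: ler_wpM2l; [exact: modulus_ge0|exact: wsup_ge].
Qed.

(** The reverse inequality is [wsupZ_le] for the inverse scalar. *)
Lemma wsupZ a x : wsup (a *: x) = modulus a * wsup x.
Proof.
apply/le_anti; rewrite wsupZ_le /=.
have [->|a0] := eqVneq a 0; first by rewrite modulus0 mul0r wsup_ge0.
rewrite -{1}[x]scale1r -(mulVf a0) -scalerA.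
apply: le_trans (ler_wpM2l (modulus_ge0 a) (wsupZ_le _ _)) _.
by rewrite mulrA -modulusM mulfV // modulus1 mul1r.
Qed.

Lemma wsupD x y : wsup (x + y) <= wsup x + wsup y.
Proof.
apply: wsup_le => b Bb; rewrite coordD //.
apply: le_trans (lerD (wsup_ge x Bb) (wsup_ge y Bb)).
by rewrite -mulrDr ler_wpM2l ?le_modulusD // ltW // w_gt0.
Qed.

Lemma wsup_gt0 x : x != 0 -> 0 < wsup x.
Proof.
move=> x0; rewrite lt0r wsup_ge0 andbT; apply: contra_neq x0 => x0.
apply: (coord_eq0 iB spanB) => b Bb; apply: modulus_eq0; apply/le_anti.
rewrite modulus_ge0 andbT -(pmulr_rle0 _ (w_gt0 Bb)) -x0.
exact: wsup_ge.
Qed.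

Definition wsup_norm : vnorm X := VNorm (vnorm_seminorm :=
  Seminorm wsup_ge0 wsupZ wsupD) wsup_gt0.

Lemma wsup_basis b : B b -> wsup b <= w b.
Proof.
move=> Bb; apply: wsup_le => c Bc.
have [->|/eqP cb] := eqVneq c b; first by rewrite coord_id // modulus1 mulr1.
by rewrite coord_neq // => [|/esym//]; rewrite modulus0 mulr0 ltW // w_gt0.
Qed.

End WeightedSupNorm.

(** * Continuity of a seminorm *)

Section Continuity.
Variables (R : realType) (k : field_choice) (X : lmodType (scalars R k)).
Implicit Types (S : seminorm X) (N : vnorm X).

Lemma seminormN S x : S (- x) = S x.
Proof. by rewrite -scaleN1r seminormZ modulusN1 mul1r. Qed.

Lemma seminorm_le_distr S x y : `|S x - S y| <= S (x - y).
Proof.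
rewrite ler_norml; apply/andP; split; last first.
  by rewrite lerBlDr -{1}(subrK y x) seminormD.
rewrite lerNl opprB lerBlDr -(seminormN S (x - y)) opprB.
by rewrite -{1}(subrK x y) seminormD.
Qed.

Lemma norm_dominating S N : exists M : vnorm X, forall x, S x <= M x.
Proof.
have ge0 x : 0 <= S x + N x by rewrite addr_ge0 ?seminorm_ge0.
have Z a x : S (a *: x) + N (a *: x) = modulus a * (S x + N x).
  by rewrite !seminormZ mulrDr.
have D x y : S (x + y) + N (x + y) <= (S x + N x) + (S y + N y).
  by rewrite addrACA lerD ?seminormD.
have gt0 x : x != 0 -> 0 < S x + N x.
  by move=> x0; rewrite ltr_wpDl ?seminorm_ge0 ?vnorm_gt0.
exists (VNorm (vnorm_seminorm := Seminorm ge0 Z D) gt0) => x /=.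
by rewrite lerDl seminorm_ge0.
Qed.

Lemma continuous_normedP S N x :
  {for x, continuous (S : normed_by N -> R)} <->
  forall e, 0 < e ->
    exists2 d, 0 < d & forall y, N (x - y) < d -> `|S x - S y| < e.
Proof.
have F := @nbhs_filter (normed_by N) x.
split=> [/(@cvgrPdist_lt _ R^o _ _ F _ _).1 Sx e /Sx|Sx].
  move=> /(@nbhs_ballP R (normed_by N))[d /= d0 xd].
  by exists d => // y xy; exact: xd.
apply/(@cvgrPdist_lt _ R^o _ _ F _ _) => e /Sx[d d0 xd].
by apply/(@nbhs_ballP R (normed_by N)); exists d => // y; exact: xd.
Qed.

Lemma dominated_continuous S N x : (forall y, S y <= N y) ->
  {for x, continuous (S : normed_by N -> R)}.
Proof.
move=> SN; apply/continuous_normedP => e e0; exists e => // y xy.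
exact: le_lt_trans (seminorm_le_distr S x y) (le_lt_trans (SN _) xy).
Qed.

(** Continuity at one point bounds [S] on a whole ball around that point, hence
   on a ball around [0] by subadditivity, hence linearly by homogeneity. *)
Lemma continuous_at_bounded S N x :
  {for x, continuous (S : normed_by N -> R)} ->
  exists2 C, 0 <= C & forall y, S y <= C * N y.
Proof.
move=> /continuous_normedP/(_ 1 ltr01)[d d0 xd].
have S1 : 0 <= S x + S x + 1 by rewrite !addr_ge0 ?seminorm_ge0.
have near0 z : N z < d -> S z <= S x + S x + 1.
  move=> zd; have := xd (x - z); rewrite opprB addrC subrK => /(_ zd).
  rewrite distrC => /(le_lt_trans (ler_norm _)); rewrite ltrBlDr => Sxz.
  have : S z <= S x + S (x - z).
    by rewrite -(seminormN S (x - z)) opprB -{1}(subrK x z) addrC seminormD.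
  move=> /le_trans; apply; rewrite -addrA lerD2l addrC; exact: ltW.
exists ((S x + S x + 1) * (2 / d)) => [|y].
  by rewrite mulr_ge0 // divr_ge0 // ltW.
have [->|y0] := eqVneq y 0.
  by rewrite -(scale0r (0 : X)) !seminormZ modulus0 !mul0r mulr0.
have Ny := vnorm_gt0 N y0.
(* Rescale y to have norm d / 2 before using the bound near 0. *)
have t0 : 0 < d / 2 / N y by rewrite !divr_gt0.
have [t tE] := modulus_surj k (ltW t0).
have := near0 (t *: y); rewrite !seminormZ tE divfK ?gt_eqF //.
rewrite ltr_pdivrMr // ltr_pMr // ltr1n => /(_ isT).
by rewrite -ler_pdivlMl // !invf_div mulrC [N y * _]mulrC mulrA.
Qed.

End Continuity.

Theorem theorem3 (R : realType) (k : field_choice)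
    (X : lmodType (scalars R k)) (infX : infinite_dimensional X)
    (S : seminorm X) (S_neq0 : exists x : X, S x != 0) :
  (exists N : vnorm X,
     forall x : X, {for x, continuous (S : normed_by N -> R)})
  /\
  (exists N' : vnorm X,
     forall x : X, ~ {for x, continuous (S : normed_by N' -> R)}).
Proof.
have [v0 Sv0] := S_neq0.
have spanS : lin_span [set x | S x != 0] = setT.
  apply/seteqP; split=> // x _.
  have sS := lin_span_subspace [set x | S x != 0].
  have [Sx|Sx] := eqVneq (S x) 0; last exact: subset_lin_span.
  rewrite -[x](addrK v0); apply: (subspaceB sS); apply: subset_lin_span => //=.
  apply: contra_neq Sv0 => Sxv; apply/le_anti; rewrite seminorm_ge0 andbT.
  have := seminormD S (x + v0) (- x).
  by rewrite seminormN Sxv Sx addr0 addrAC subrr add0r.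
have [B [BS iB spanB]] := hamel_basis_in spanS.
have infB := infinite_basis iB spanB infX.
have B0 := infinite_setN0 infB.
split.
  have one_gt0 b : B b -> 0 < (1 : R) by [].
  have [N SN] := norm_dominating S (wsup_norm iB spanB B0 one_gt0).
  by exists N => x; exact: dominated_continuous.
have /pcard_surjP[h hB] := (infiniteP B).1 infB.
(* Weights so small that S b is h b + 1 times w b, a bound for the norm of b. *)
pose w b := S b / (h b).+1%:R.
have w_gt0 b : B b -> 0 < w b.
  by move=> /BS Sb; rewrite divr_gt0 // lt0r Sb seminorm_ge0.
exists (wsup_norm iB spanB B0 w_gt0) => x /continuous_at_bounded[C C0 SC].
(* A basis vector on which the ratio of S to the norm exceeds C. *)
have [b Bb hb] := hB (Num.truncn C) I.
have Sb : 0 < S b by rewrite lt0r (BS _ Bb) seminorm_ge0.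
have := le_trans (SC b) (ler_wpM2l C0 (wsup_basis iB B0 w_gt0 Bb)).
rewrite /w hb mulrCA ler_pMr // ler_pdivlMr // mul1r leNgt.
by rewrite truncnS_gt.
Qed.
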